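(* Let $n\in\mathbb{N}$, let $H\subseteq\mathbb{R}$ with $|H|\ge n+2$, let $\omega=(\omega_1,\dots,\omega_n):H\to\mathbb{R}^n$ be an $n$-dimensional positive Chebyshev system over $H$, and let $\omega_{n+1}:H\to\mathbb{R}$ be such that $\omega^*=(\omega_1,\dots,\omega_n,\omega_{n+1})$ is an $(n+1)$-dimensional positive Chebyshev system over $H$. Let $m\in\mathbb{N}$ with $n\le m\le |H|-1$, let $x_0<\dots<x_m$ be elements of $H$, and let $f:\{x_0,\dots,x_m\}\to\mathbb{R}$. If, for all $0\le i\le m-n$, $f$ is $\omega$-convex on the $(n+1)$-element set $\{x_i,\dots,x_{i+n}\}$, i.e., $$\Phi_{(\omega,f)}(x_i,\dots,x_{i+n})\ge0,$$ then $f$ is $\omega$-convex on $\{x_0,\dots,x_m\}$, i.e., for all integers $0\le i_0<\dots<i_n\le m$, $$\Phi_{(\omega,f)}(x_{i_0},\dots,x_{i_n})\ge0.$$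
   Context: $\mathbb{N}$ is the set of positive integers. For $H\subseteq\mathbb{R}$ and $k\in\mathbb{N}$, $\sigma_k(H):=\{(x_1,\dots,x_k)\in H^k\mid x_1<\dots<x_k\}$. For $\omega=(\omega_1,\dots,\omega_k):H\to\mathbb{R}^k$ and $(x_1,\dots,x_k)\in\sigma_k(H)$, $\Phi_\omega(x_1,\dots,x_k):=\det\big(\omega_i(x_j)\big)_{i,j=1}^k$. $\omega$ is a $k$-dimensional positive Chebyshev system over $H$ if $\Phi_\omega>0$ on $\sigma_k(H)$ (where $|H|\ge k$). For an $n$-dimensional $\omega$ and a real function $f$, $(\omega,f):=(\omega_1,\dots,\omega_n,f)$. A real function $f$ is $\omega$-convex on a set $S\subseteq H$ if $\Phi_{(\omega,f)}\ge0$ on $\sigma_{n+1}(S)$. If $H$ is infinite, the condition $m\le|H|-1$ is vacuous. (The auxiliary function $\omega_{n+1}$ is part of the paper's standing setting; it does not enter the conclusion.) *)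

(* Defs.v *)
From mathcomp Require Import all_boot all_order all_algebra.
From mathcomp Require Import all_classical all_reals.

Set Implicit Arguments.
Unset Strict Implicit.
Unset Printing Implicit Defensive.

Import Order.TTheory GRing.Theory Num.Theory.
Local Open Scope classical_set_scope.
Local Open Scope card_scope.
Local Open Scope ring_scope.

(* Functions defined on a subset of R are represented by total functions
   R -> R: [positive_chebyshev] and [omega_convex] evaluate them only at points
   of the given set, so the values elsewhere are irrelevant. *)

Definition sigma (R : realType) (k : nat) (H : set R) :
    set ('I_k -> R) :=
  [set x | (forall j, H (x j)) /\ (forall i j : 'I_k, (i < j)%N -> x i < x j)].
Arguments sigma {R} k H.

Definition Phi (R : realType) (k : nat) (omega : 'I_k -> R -> R)
    (x : 'I_k -> R) : R :=
  \det (\matrix_(i < k, j < k) omega i (x j)).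

(* [`I_k #<= H] says that H, finite or infinite, has at least k elements. *)
Definition positive_chebyshev (R : realType) (k : nat)
    (omega : 'I_k -> R -> R) (H : set R) : Prop :=
  `I_k #<= H /\ forall x, sigma k H x -> 0 < Phi omega x.

(* (omega_1, ..., omega_n, f): [unlift ord_max i] is [None] exactly when i is
   the last index, and otherwise [Some j] where j has the same value as i. *)
Definition adjoin (R : realType) (n : nat) (omega : 'I_n -> R -> R)
    (f : R -> R) : 'I_n.+1 -> R -> R :=
  fun i => oapp omega f (unlift ord_max i).

Definition omega_convex (R : realType) (n : nat) (omega : 'I_n -> R -> R)
    (f : R -> R) (S : set R) : Prop :=
  forall y, sigma n.+1 S y -> 0 <= Phi (adjoin omega f) y.

(* Main.v *)
(** Expanding Phi_(omega,f) along its last row shows that it is linear in f and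
    vanishes when f is one of the omega_i.  Given y_0 < ... < y_(n+1), one may
    therefore subtract from f its omega-interpolant at the n interior points.
    Then nonnegativity of Phi_(omega,f) at (y_0, ..., y_n) and at
    (y_1, ..., y_(n+1)) fixes the signs of f(y_0) and f(y_(n+1)), and these
    signs make Phi_(omega,f) nonnegative when any other y_j is omitted.
    The theorem follows by induction on i_n - i_0: if the indices are not
    consecutive, insert a missing one; dropping either extreme index then
    shortens the span. *)

Require Import Defs.
From mathcomp Require Import all_boot all_order all_algebra.
From mathcomp Require Import all_classical all_reals.
From mathcomp Require Import zify.

Set Implicit Arguments.
Unset Strict Implicit.
Unset Printing Implicit Defensive.

Import Order.TTheory GRing.Theory Num.Theory.
Local Open Scope classical_set_scope.
Local Open Scope card_scope.
Local Open Scope ring_scope.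

Section LastRow.
Variables (R : realType) (n : nat) (omega : 'I_n -> R -> R).
Implicit Types (f : R -> R) (c : 'I_n -> R).

Lemma Phi_adjoinE f (y : 'I_n.+1 -> R) :
  Phi (adjoin omega f) y =
    \sum_k f (y k) * ((-1) ^+ (n + k) * Phi omega (y \o lift k)).
Proof.
rewrite /Phi (expand_det_row _ ord_max); apply: eq_bigr => k _.
rewrite mxE /adjoin unlift_none /cofactor /=; congr (_ * (_ * \det _)).
by apply/matrixP => i j; rewrite !mxE liftK.
Qed.

Lemma Phi_adjoin_self (i : 'I_n) (y : 'I_n.+1 -> R) :
  Phi (adjoin omega (omega i)) y = 0.
Proof.
apply: (@determinant_alternate _ _ _ (lift ord_max i) ord_max).
  by rewrite eq_sym neq_lift.
by move=> j; rewrite !mxE /adjoin liftK unlift_none.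
Qed.

Lemma Phi_adjoin_sub_comb f c (y : 'I_n.+1 -> R) :
  Phi (adjoin omega (fun t => f t - \sum_i c i * omega i t)) y =
  Phi (adjoin omega f) y.
Proof.
rewrite !Phi_adjoinE; under eq_bigr do rewrite mulrBl mulr_suml.
rewrite sumrB exchange_big /= [X in _ - X]big1 ?subr0// => i _.
under eq_bigr do rewrite -mulrA.
by rewrite -mulr_sumr -Phi_adjoinE Phi_adjoin_self mulr0.
Qed.

(** A row vector [c] with [c *m A] equal to the values of [f] exists because the collocation matrix
    is invertible. *)
Lemma interpolation f (z : 'I_n -> R) : Phi omega z != 0 ->
  exists c, forall j, \sum_i c i * omega i (z j) = f (z j).
Proof.
rewrite /Phi; set A := (X in \det X) => A_neq0.
have A_unit : A \in unitmx by rewrite unitmxE unitfE.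
exists (fun i => ((\row_j f (z j)) *m invmx A) 0 i) => j.
have /rowP/(_ j) := mulmxKV A_unit (\row_j f (z j)).
by rewrite !mxE => <-; apply: eq_bigr => i _; rewrite [A _ _]mxE.
Qed.

Lemma Phi_adjoin_lift_ge0 f (y : 'I_n.+2 -> R) (j : 'I_n.+2) :
  (forall z, sigma n (range y) z -> 0 < Phi omega z) ->
  (forall i k : 'I_n.+2, (i < k)%N -> y i < y k) ->
  0 <= Phi (adjoin omega f) (y \o lift ord0) ->
  0 <= Phi (adjoin omega f) (y \o lift ord_max) ->
  0 <= Phi (adjoin omega f) (y \o lift j).
Proof.
move=> Phi_gt0 y_inc.
have lift_lt p (h : 'I_p) (a b : 'I_p.-1) : (a < b)%N -> (lift h a < lift h b)%N.
  by rewrite /= /bump; lia.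
(* Omitting two points leaves an increasing tuple, so in every expansion below the signs of the
   cofactors come from the powers of -1 alone. *)
have Phi2_gt0 (h : 'I_n.+2) (k : 'I_n.+1) :
    0 < Phi omega ((y \o lift h) \o lift k).
  apply: Phi_gt0; split=> [i|a b ab] /=; first by exists (lift h (lift k i)).
  by apply: y_inc; do 2!apply: (lift_lt).
(* Removing the last point and then the first leaves the interior points y_1, ..., y_n as nodes. *)
have [c cP] := interpolation f (lt0r_neq0 (Phi2_gt0 ord_max ord0)).
rewrite -!(Phi_adjoin_sub_comb f c).
set g := fun t => f t - _.
have g0 (i : 'I_n.+2) : i != ord0 -> i != ord_max -> g (y i) = 0.
  rewrite -!val_eqE /= => i0 im.
  have lt_in : (i.-1 < n)%N by have := ltn_ord i; lia.
  have -> : i = lift ord_max (lift ord0 (Ordinal lt_in)).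
    by apply: val_inj; rewrite /= /bump; lia.
  by rewrite /g -[y _]/(((y \o lift ord_max) \o lift ord0) (Ordinal lt_in)) cP subrr.
rewrite !Phi_adjoinE => sum0 summax.
(* With y_0 omitted, only y_(n+1) contributes; it sits at position n, where the sign (-1)^(n+n) is
   1. *)
have gmax : 0 <= g (y ord_max).
  move: sum0; rewrite (bigD1 ord_max)//= big1 ?addr0 => [|k kmax]; last first.
    rewrite g0 ?mul0r// -val_eqE /= /bump; move: kmax; rewrite -val_eqE /=; lia.
  have -> : lift ord0 ord_max = ord_max :> 'I_n.+2 by apply: val_inj.
  by rewrite -signr_odd addnn odd_double expr0 mul1r pmulr_lge0 ?Phi2_gt0.
(* With y_(n+1) omitted, only y_0 contributes; it sits at position 0, so the sign (-1)^n remains. *)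
have gmin : 0 <= g (y ord0) * (-1) ^+ n.
  move: summax; rewrite (bigD1 ord0)//= big1 ?addr0 => [|k k0]; last first.
    rewrite g0 ?mul0r// -val_eqE /= /bump; move: k0; rewrite -val_eqE /=;
      have := ltn_ord k; lia.
  have -> : lift ord_max ord0 = ord0 :> 'I_n.+2 by apply: val_inj.
  by rewrite addn0 mulrA pmulr_lge0 ?Phi2_gt0.
have [->|j0] := eqVneq j ord0; first by rewrite sum0.
have [->|jmax] := eqVneq j ord_max; first by rewrite summax.
(* For interior j, y_0 is still at position 0 and y_(n+1) at position n, so their terms carry the
   signs just found; all other terms vanish. *)
apply: sumr_ge0 => k _; rewrite mulrA; apply: mulr_ge0; last exact: ltW.
rewrite /=; have [l0|l0] := eqVneq (lift j k) ord0.
  have k0 : k = 0%N :> nat.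
    by move/(congr1 val): l0; rewrite /= /bump; lia.
  by rewrite l0 k0 addn0.
have [lm|lm] := eqVneq (lift j k) ord_max; last by rewrite g0 ?mul0r.
have kn : k = n :> nat.
  move/(congr1 val): lm; rewrite /= /bump.
  by move: jmax; rewrite -val_eqE /=; have := ltn_ord j; have := ltn_ord k; lia.
by rewrite lm kn -signr_odd addnn odd_double expr0 mulr1.
Qed.

End LastRow.

Lemma ltn_step (s : nat -> nat) (n : nat) :
  (forall i, (i < n)%N -> (s i < s i.+1)%N) ->
  forall i j, (i < j <= n)%N -> (s i < s j)%N.
Proof.
move=> s_step i; elim=> [//|j IHj] /andP[ij jn].
have sj := s_step j jn.
have [->//|ne] := eqVneq i j.
by apply: ltn_trans sj; apply: IHj; lia.
Qed.

Lemma no_gap (s : nat -> nat) (n : nat) :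
  (forall i, (i < n)%N -> s i.+1 = (s i).+1) ->
  forall i, (i <= n)%N -> s i = (s 0%N + i)%N.
Proof.
move=> s_step; elim=> [|i IHi] lt_in; first by rewrite addn0.
by rewrite s_step// IHi ?addnS// ltnW.
Qed.

(** Points and index choices are functions on [nat], so that shifting and inserting indices is plain
    arithmetic; only [x] up to [m] and [s] up to [n] matter. *)
Lemma Phi_consecutive_ge0 (R : realType) (n m : nat) (omega : 'I_n -> R -> R)
    (f : R -> R) (x : nat -> R) :
  (forall i j, (i < j <= m)%N -> x i < x j) ->
  (forall z, sigma n (x @` [set i | (i <= m)%N]) z -> 0 < Phi omega z) ->
  (forall i, (i + n <= m)%N ->
     0 <= Phi (adjoin omega f) (fun k : 'I_n.+1 => x (i + k)%N)) ->
  forall s : nat -> nat, (forall i, (i < n)%N -> (s i < s i.+1)%N) ->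
    (s n <= m)%N -> 0 <= Phi (adjoin omega f) (fun k : 'I_n.+1 => x (s k)).
Proof.
move=> x_inc Phi_gt0 f_loc s.
have [d] := ubnP (s n - s 0%N); elim: d s => // d IHd s le_d s_step le_sm.
have [[i [lt_in gap]]|nogap] :=
    pselect (exists i, (i < n)%N /\ (s i).+1 != s i.+1); last first.
  have sE : forall i, (i <= n)%N -> s i = (s 0%N + i)%N.
    apply: no_gap => i lt_in; apply/eqP; rewrite eq_sym.
    by apply: contra_notT nogap => ?; exists i.
  have -> : (fun k : 'I_n.+1 => x (s k)) = (fun k : 'I_n.+1 => x (s 0%N + k)%N).
    by apply/funext => k; rewrite sE// -ltnS.
  by apply: f_loc; rewrite -sE.
(* [t] inserts the skipped index [(s i).+1] right after [s i] and shifts the later entries by one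
   place. *)
pose t k := if (k <= i)%N then s k else if k == i.+1 then (s i).+1 else s k.-1.
have t_step k : (k < n.+1)%N -> (t k < t k.+1)%N.
  have := s_step k; have := s_step i lt_in; have := s_step k.-1; rewrite /t.
  case: (ltngtP k i) => [ki|ki|->].
  - by lia.
  - rewrite (_ : k.+1 == i.+1 = false); last by lia.
    (* At k = i+1 the claim is [(s i).+1 < s i.+1], which is where the gap is used. *)
    case: eqVneq => [->|ne] /=; first by move/eqP: gap; lia.
    by rewrite prednK; lia.
  - by rewrite eqxx.
have t0 : t 0%N = s 0%N by [].
have tn : t n.+1 = s n by rewrite /t ifF ?ifF//; lia.
have t_inc := ltn_step t_step.
have ij : (i.+1 < n.+2)%N by lia.
(* Omitting position i+1 from [t] gives [s] back. *)
have -> : (fun k : 'I_n.+1 => x (s k)) =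
    (fun k : 'I_n.+2 => x (t k)) \o lift (Ordinal ij).
  apply/funext => k /=; congr (x _); rewrite /t /bump.
  by case: (ltnP i k) => ik /=; [rewrite !ifF//=; lia | rewrite add0n ik].
have t_le k : (k <= n.+1)%N -> (t k <= m)%N.
  rewrite leq_eqVlt => /orP[/eqP->|kn]; first by rewrite tn.
  by have := t_inc k n.+1; rewrite tn; lia.
apply: Phi_adjoin_lift_ge0.
- move=> z [zy z_inc]; apply: Phi_gt0; split=> // k.
  by have [l _ <-] := zy k; exists (t l) => //=; apply: t_le; rewrite -ltnS.
- move=> a b ab; apply: x_inc; rewrite t_inc ?t_le//; have := ltn_ord b; lia.
- have -> : (fun k : 'I_n.+2 => x (t k)) \o lift ord0 =
      (fun k : 'I_n.+1 => x (t k.+1)) by apply/funext.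
  (* The tuple now starts at [t 1 > s 0] and still ends at [s n], so its span is smaller. *)
  apply: (IHd (fun k => t k.+1)) => [|k kn|]; last by rewrite tn.
    by have := t_inc 0%N 1%N; have := t_inc 0%N n.+1; rewrite tn t0; lia.
  by apply: t_step.
- have -> : (fun k : 'I_n.+2 => x (t k)) \o lift ord_max =
      (fun k : 'I_n.+1 => x (t k)).
    by apply/funext => k /=; rewrite /bump leqNgt ltn_ord.
  (* Here the start [s 0] is kept and the end drops to [t n < s n]. *)
  apply: IHd => [|k kn|]; last exact: t_le.
    by have := t_inc n n.+1; have := t_inc 0%N n.+1; rewrite tn t0; lia.
  by apply: t_step; lia.
Qed.

Theorem corollary4 (R : realType) (n : nat) (n_gt0 : (0 < n)%N)
    (H : set R) (card_H : `I_n.+2 #<= H)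
    (omega : 'I_n -> R -> R) (omega_cheb : positive_chebyshev omega H)
    (omegaS : R -> R)
    (omegaS_cheb : positive_chebyshev (adjoin omega omegaS) H)
    (m : nat) (le_nm : (n <= m)%N) (le_mH : `I_m.+1 #<= H)
    (x : 'I_m.+1 -> R) (xH : sigma m.+1 H x) (f : R -> R)
    (f_loc : forall i : nat, (i <= m - n)%N ->
       omega_convex omega f (x @` [set j : 'I_m.+1 | (i <= j <= i + n)%N])) :
  omega_convex omega f (range x).
Proof.
have [xH_in x_inc] := xH.
(* Beyond [m], [inord] defaults to index 0; [X] is only used up to [m]. *)
pose X i := x (inord i).
have XE (i : 'I_m.+1) : X i = x i by rewrite /X inord_val.
have X_inc i j : (i < j <= m)%N -> X i < X j.
  by move=> ijm; apply: x_inc; rewrite !inordK; lia.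
have X_gt0 z : sigma n (X @` [set i | (i <= m)%N]) z -> 0 < Phi omega z.
  move=> [zX z_inc]; apply: (omega_cheb.2); split=> // k.
  by have [l _ <-] := zX k; apply: xH_in.
have X_loc i : (i + n <= m)%N ->
    0 <= Phi (adjoin omega f) (fun k : 'I_n.+1 => X (i + k)%N).
  move=> inm; apply: (f_loc i); first lia.
  split=> [k|a b ab].
    have kn := ltn_ord k.
    by exists (inord (i + k)) => //=; rewrite inordK; lia.
  by apply: X_inc; have := ltn_ord b; lia.
move=> y [yx y_inc].
have /choice[s sE] : forall k, exists j, x j = y k.
  by move=> k; have [j _ <-] := yx k; exists j.
have -> : y = (fun k : 'I_n.+1 => X (s (inord k))).
  by apply/funext => k; rewrite XE inord_val sE.
apply: (Phi_consecutive_ge0 X_inc X_gt0 X_loc (s := fun k => s (inord k)));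
  last by rewrite -ltnS.
(* The chosen indices increase: [s] reversing or repeating an index would, as [x] is increasing,
   contradict the strict order of [y]. *)
move=> i lt_in; rewrite ltnNge; apply/negP => le_s.
have : y (inord i) < y (inord i.+1) by apply: y_inc; rewrite !inordK; lia.
rewrite -!sE; apply/negP; rewrite -leNgt.
move: le_s; rewrite leq_eqVlt => /orP[/eqP/val_inj->//|/x_inc/ltW//].
Qed.
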